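(* For every $n\geq 0$, the number of $F$-equivalence classes of the set $\mathcal{L}_n$ of Łukasiewicz paths of length $n$ is $2^n-n$.
   Context: A Łukasiewicz path of length $n$ is a sequence of $n$ steps from $\{(1,i): i\geq -1\}$ starting at $(0,0)$, ending at $(n,0)$ and never going below the $x$-axis. Write $D=(1,-1)$, $F=(1,0)$, $U_i=(1,i)$ for $i\geq1$. Steps are numbered $1,\dots,n$; an occurrence of a pattern (one step or two consecutive steps) is at position $i$ if its first step is the $i$-th step. Two paths of the same length are $\alpha$-equivalent if the sets of occurrence positions of the pattern $\alpha$ in them are identical. *)

(* Defs.v *)
From mathcomp Require Import all_boot all_order all_algebra.
From mathcomp Require Import boolp classical_sets functions cardinality.

Set Implicit Arguments.
Unset Strict Implicit.
Unset Printing Implicit Defensive.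
Import Order.TTheory GRing.Theory Num.Theory.
Local Open Scope classical_set_scope.
Local Open Scope ring_scope.

(* The step (1, i) is encoded by its vertical displacement i; thus D, F and
   U_i are the integers -1, 0 and i. *)
Definition F : int := 0.

(* The ordinate of the path after its first k steps. *)
Definition height (n : nat) (p : n.-tuple int) (k : nat) : int :=
  \sum_(s <- take k p) s.

Definition Lukasiewicz (n : nat) : set (n.-tuple int) :=
  [set p | [/\ (forall s : int, s \in p -> -1 <= s),
               (forall k : nat, (k <= n)%N -> 0 <= height p k)
             & height p n = 0]].
Arguments Lukasiewicz n : clear implicits.

(* Positions are numbered from 1. *)
Definition occurrences (alpha : seq int) (n : nat) (p : n.-tuple int) :
    set nat :=
  [set i : nat | (0 < i)%N /\ prefix alpha (drop i.-1 p)].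

Definition pattern_equiv (alpha : seq int) (n : nat) (p q : n.-tuple int) :
    Prop :=
  occurrences alpha p = occurrences alpha q.

Definition pattern_classes (alpha : seq int) (n : nat) :
    set (set (n.-tuple int)) :=
  [set [set q | Lukasiewicz n q /\ pattern_equiv alpha p q]
    | p in Lukasiewicz n].
Arguments pattern_classes alpha n : clear implicits.

(* Main.v *)
Require Import Defs.
From mathcomp Require Import all_boot all_order all_algebra.
From mathcomp Require Import boolp classical_sets functions cardinality.
From mathcomp Require Import zify.

(** The class of a path is determined by the set of positions of its steps
other than [F]. This set is never a singleton, since the steps sum to [0]; and
every other set of [m] positions comes from a path: if [m >= 2], let the first
of these steps be [U_(m-1)] and the others [D]. Hence there are as many classes
as subsets of an [n]-element set that are not singletons. *)

Local Open Scope classical_set_scope.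

Section Arch.
Import Order.TTheory GRing.Theory Num.Theory.
Local Open Scope ring_scope.

(** A mark [true] becomes the step [D] and [false] becomes [F]. *)
Definition descents (b : seq bool) : seq int := [seq - (nat_of_bool x)%:Z | x <- b].

(** With [m] marks in all, [m - 1] remain after the first one, whose step is therefore $U_{m-1}$; a
    lone mark degenerates to [F]. *)
Fixpoint arch (b : seq bool) : seq int :=
  if b is x :: b' then
    if x then (count id b')%:Z :: descents b' else 0 :: arch b'
  else [::].

Lemma size_arch (b : seq bool) : size (arch b) = size b.
Proof. by elim: b => //= -[] b /= IHb; rewrite ?size_map ?IHb. Qed.

Lemma sum_descents (b : seq bool) : \sum_(s <- descents b) s = - (count id b)%:Z.
Proof.
elim: b => [|x b IHb]; first by rewrite big_nil oppr0.
by rewrite big_cons IHb -opprD.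
Qed.

(** The height is 0 before the first mark; after it, the height is the number of marks still to
    come. *)
Lemma sum_take_arch_ge0 (b : seq bool) (k : nat) :
  0 <= \sum_(s <- take k (arch b)) s.
Proof.
elim: b k => [|[] b IHb] [|k] /=; rewrite ?big_nil ?big_cons ?add0r //.
rewrite /descents -map_take sum_descents subr_ge0 lez_nat.
by rewrite -{2}(cat_take_drop k b) count_cat leq_addr.
Qed.

Lemma sum_arch (b : seq bool) : \sum_(s <- arch b) s = 0.
Proof.
elim: b => [|[] b IHb] /=; rewrite ?big_nil ?big_cons ?add0r //.
by rewrite sum_descents subrr.
Qed.

Lemma arch_geN1 (b : seq bool) (s : int) : s \in arch b -> -1 <= s.
Proof.
elim: b => [|[] b IHb] //=; rewrite inE => /orP[/eqP-> //|]; last exact: IHb.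
by case/mapP => -[] _ ->.
Qed.

Lemma descents_neq0 (b : seq bool) : [seq s != 0 | s <- descents b] = b.
Proof. by elim: b => //= -[] b ->. Qed.

Lemma arch_neq0 (b : seq bool) :
  count id b != 1%N -> [seq s != 0 | s <- arch b] = b.
Proof.
elim: b => [|[] b IHb] //= nb; last by rewrite IHb.
(* The first marked step is nonzero because another mark follows it. *)
by rewrite descents_neq0; congr (_ :: _); lia.
Qed.

Lemma arch_tupleP (n : nat) (b : n.-tuple bool) : size (arch b) == n.
Proof. by rewrite size_arch size_tuple. Qed.

Definition arch_tuple (n : nat) (b : n.-tuple bool) : n.-tuple int :=
  Tuple (arch_tupleP n b).

Lemma arch_Lukasiewicz (n : nat) (b : n.-tuple bool) :
  Lukasiewicz n (arch_tuple n b).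
Proof.
split=> [s|k _|]; [exact: arch_geN1 | exact: sum_take_arch_ge0 |].
by rewrite /height take_oversize ?size_tuple ?sum_arch.
Qed.

Definition nonflat (n : nat) (p : n.-tuple int) : {set 'I_n} :=
  [set i | tnth p i != 0]%SET.

(** A single nonzero step would equal the sum of all steps, which is 0. *)
Lemma nonflat_Lukasiewicz (n : nat) (p : n.-tuple int) :
  Lukasiewicz n p -> #|nonflat n p| != 1%N.
Proof.
case=> _ _; rewrite /height take_oversize ?size_tuple // big_tuple => sum0.
apply/negP => /cards1P[i pi].
have [ni others] : tnth p i != 0 /\ forall j, j != i -> tnth p j = 0.
  split=> [|j ji].
    by have : i \in nonflat n p; [rewrite pi finset.set11 | rewrite inE].
  by apply: contraNeq ji => pj; rewrite -finset.in_set1 -pi inE.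
by move: sum0 ni; rewrite (bigD1 i) //= big1 // addr0 => ->; rewrite eqxx.
Qed.

Lemma nonflat_surj (n : nat) (N : {set 'I_n}) :
  #|N| != 1%N -> exists2 p, Lukasiewicz n p & nonflat n p = N.
Proof.
(* [b] is the indicator sequence of [N]. *)
move=> N1; pose b := [tuple i \in N | i < n].
exists (arch_tuple n b); first exact: arch_Lukasiewicz.
have b1 : count id b != 1%N.
  by rewrite cardE in N1; rewrite /= count_map -size_filter enumT.
have ib (i : 'I_n) : (i < size (arch b))%N by rewrite size_arch size_tuple.
apply/setP => i; rewrite inE (tnth_nth 0) -[tval _]/(arch b).
rewrite -(nth_map 0 false (fun s => s != 0) (ib i)).
by rewrite (arch_neq0 b b1) -(tnth_nth false b) tnth_mktuple.
Qed.

(** Ordinals count from 0 and positions from 1, hence the shift to [i.+1]. *)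
Lemma occurrences_F (n : nat) (p : n.-tuple int) (i : 'I_n) :
  occurrences [:: F] p i.+1 <-> i \notin nonflat n p.
Proof.
rewrite /occurrences /= inE negbK (tnth_nth 0) (drop_nth 0) ?size_tuple //=.
by rewrite prefix0s andbT eq_sym; split=> [[]|].
Qed.

Lemma pattern_equiv_F (n : nat) (p q : n.-tuple int) :
  pattern_equiv [:: F] p q <-> nonflat n p = nonflat n q.
Proof.
split=> [pq|].
  apply/setP => i; apply: negb_inj; apply/idP/idP => /occurrences_F.
    by rewrite pq => /occurrences_F.
  by rewrite -pq => /occurrences_F.
(* By symmetry, one inclusion is enough. *)
suff sub p' q' : nonflat n p' = nonflat n q' ->
    occurrences [:: F] p' `<=` occurrences [:: F] q'.
  by move=> pq; apply/seteqP; split; apply: sub.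
(* Position 0 is excluded by definition; beyond the end of the path the remaining suffix is empty
   and cannot begin with [F]. *)
move=> pq [[]//|i]; have [ni|ni] := ltnP i n; last first.
  by case=> _; rewrite /= drop_oversize ?size_tuple.
by move/(occurrences_F _ _ (Ordinal ni)); rewrite pq => /occurrences_F.
Qed.

End Arch.

Lemma card_non_singletons (n : nat) :
  #|[set N : {set 'I_n} | #|N| != 1]%SET| = 2 ^ n - n.
Proof.
have -> : [set N : {set 'I_n} | #|N| != 1]%SET =
          (~: [set N : {set 'I_n} | #|N| == 1])%SET.
  by apply/setP => N; rewrite !inE.
(* The complement consists of the $\binom{n}{1} = n$ singletons. *)
by rewrite cardsCs finset.setCK card_draws card_ord bin1 -cardsT -powersetT
           card_powerset cardsT card_ord.
Qed.

Theorem theorem2 (n : nat) :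
  (pattern_classes [:: F] n #= `I_(2 ^ n - n))%card.
Proof.
rewrite -card_non_singletons; set A := [set N | _]%SET.
(* The classes are indexed by the numbering of the admissible sets in [A]. *)
pose cls (k : 'I_#|A|) :=
  [set q | Lukasiewicz n q /\ nonflat n q = enum_val k].
have -> : pattern_classes [:: F] n = range cls.
  apply/seteqP; split=> C.
    case=> p Lp <-.
    have Ap : nonflat n p \in A by rewrite inE nonflat_Lukasiewicz.
    exists (enum_rank_in Ap (nonflat n p)) => //.
    apply/seteqP; rewrite /cls enum_rankK_in //; split=> q /= [Lq pq]; split=> //.
      by have /pattern_equiv_F := pq.
    exact/pattern_equiv_F.
  case=> k _ <-; have := enum_valP k; rewrite inE => /nonflat_surj[p Lp pk].
  exists p => //; apply/seteqP; rewrite /cls -pk; split=> q /= [Lq pq]; split=> //.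
    by have /pattern_equiv_F := pq.
  exact/pattern_equiv_F.
(* [cls] is injective: each class has a member, and the nonflat set of that member determines the
   index. *)
apply: card_eq_trans (card_esym card_II); apply: inj_card_eq => k l _ _ kl.
have := enum_valP k; rewrite inE => /nonflat_surj[p Lp pk].
have : cls k p by [].
by rewrite kl => -[_]; rewrite pk => /enum_val_inj.
Qed.
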